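(* Let $\{t_n\}_{n=0}^\infty\subset[0,1]$. The following two statements are equivalent: (i) $\{t_n\}$ satisfies condition (T): for every sequence $\{a_\nu\}_{\nu\ge 1}\in\ell_2$ with $a_\nu\ge 0$ for all $\nu$, $$\liminf_{m\to\infty}\frac{a_m}{t_m}\sum_{\nu=1}^m a_\nu=0.$$ (ii) For every real Hilbert space $H$, every family $\{C_\alpha\}_{\alpha\in\Omega}$ ($|\Omega|\ge 2$) of closed convex subsets of $H$ which is uniformly quasi-symmetric with respect to some point $a\in C=\bigcap_{\alpha\in\Omega}C_\alpha$, and every starting element $x_0\in H$, every sequence $\{x_n\}$ of remote projections onto $\{C_\alpha\}$ with weakness parameters $\{t_n\}$ starting at $x_0$ converges in norm to a point of $C$.
   Context: $H$ denotes a real Hilbert space with inner product $\langle\cdot,\cdot\rangle$ and norm $|\cdot|$; $P_\alpha$ denotes the metric (nearest point) projection onto the closed convex set $C_\alpha$, and $B(0,r)$ the closed ball of radius $r$ centered at $0$. Remote projections: given a family $\{C_\alpha\}_{\alpha\in\Omega}$ of closed convex sets with nonempty intersection, weakness parameters $t_n\in[0,1]$ and $x_0\in H$, a sequence of remote projections is defined by $x_{n+1}=P_{\alpha(n)}x_n$ ($n=0,1,2,\dots$), where $\alpha(n)\in\Omega$ is any index with $\mathrm{dist}(x_n,C_{\alpha(n)})\ge t_n\sup_{\alpha\in\Omega}\mathrm{dist}(x_n,C_\alpha)$; if $t_n=1$ for at least one $n$, it is additionally required that $\max_\alpha\mathrm{dist}(x,C_\alpha)$ is attained for every $x\in H$.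 A family $\{C_\alpha\}$ of closed convex sets all containing $0$ is uniformly quasi-symmetric if for every $r>0$ there is $\theta=\theta(r)\in(0,1]$ such that for all $\alpha$, $x\in C_\alpha\cap B(0,r)$ implies $-\theta x\in C_\alpha$. The family is uniformly quasi-symmetric with respect to a point $a\in\bigcap_\alpha C_\alpha$ if the family $\{C_\alpha-a\}$ is uniformly quasi-symmetric. *)

(* Defs.v *)
From HB Require Import structures.
From mathcomp Require Import all_boot all_order all_algebra.
From mathcomp Require Import all_classical all_reals all_analysis.
Set Implicit Arguments. Unset Strict Implicit. Unset Printing Implicit Defensive.
Import Order.TTheory GRing.Theory Num.Theory.
Import numFieldNormedType.Exports.
Local Open Scope classical_set_scope.
Local Open Scope ring_scope.

Section Defs.
Variable R : realType.

(* The m-th term  (a_m / t_m) * sum_{nu=1}^m a_nu  as an extended real.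
   Convention for t_m = 0: the term is +oo if a_m * S_m > 0 and 0 if
   a_m * S_m = 0. *)
Definition condT_term (t a : nat -> R) (m : nat) : \bar R :=
  let p := a m * \sum_(1 <= nu < m.+1) a nu in
  if t m == 0 then (if p == 0 then 0%E else +oo%E) else (p / t m)%:E.

Definition in_l2 (a : nat -> R) : Prop :=
  cvgn (series (fun n => a n.+1 ^+ 2)).

Definition condition_T (t : nat -> R) : Prop :=
  forall a : nat -> R, (forall nu, (0 < nu)%N -> 0 <= a nu) -> in_l2 a ->
    limn_einf (condT_term t a) = 0%E.

Section Hilbert.
Variables (V : lmodType R) (ip : V -> V -> R).

Definition ipnorm (x : V) : R := Num.sqrt (ip x x).

Definition seq_converges (u : nat -> V) (l : V) : Prop :=
  forall e : R, 0 < e -> exists N : nat, forall n, (N <= n)%N -> ipnorm (u n - l) < e.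

Definition seq_cauchy (u : nat -> V) : Prop :=
  forall e : R, 0 < e -> exists N : nat,
    forall m n, (N <= m)%N -> (N <= n)%N -> ipnorm (u m - u n) < e.

Definition is_real_hilbert : Prop :=
  [/\ (forall x y, ip x y = ip y x),
      (forall (c : R) x y z, ip (c *: x + y) z = c * ip x z + ip y z),
      (forall x, 0 <= ip x x),
      (forall x, ip x x = 0 -> x = 0) &
      (forall u, seq_cauchy u -> exists l, seq_converges u l)].

Definition closed_set (A : set V) : Prop :=
  forall (u : nat -> V) l, (forall n, A (u n)) -> seq_converges u l -> A l.

Definition convex_subset (A : set V) : Prop :=
  forall x y (lam : R), A x -> A y -> 0 <= lam <= 1 ->
    A (lam *: x + (1 - lam) *: y).

Definition dist (x : V) (A : set V) : R := inf [set ipnorm (x - y) | y in A].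

Definition is_proj (A : set V) (x p : V) : Prop :=
  A p /\ forall y, A y -> ipnorm (x - p) <= ipnorm (x - y).

Definition unif_quasi_sym_wrt (Omega : Type) (C : Omega -> set V) (a : V) : Prop :=
  forall r : R, 0 < r -> exists theta : R, 0 < theta <= 1 /\
    forall alpha (x : V), C alpha (a + x) -> ipnorm x <= r ->
      C alpha (a + (- theta) *: x).

Definition remote_projections (Omega : Type) (C : Omega -> set V)
    (t : nat -> R) (x0 : V) (x : nat -> V) : Prop :=
  [/\ x 0%N = x0,
      ((exists n, t n = 1) ->
        forall y : V, exists beta, forall alpha, dist y (C alpha) <= dist y (C beta)) &
      forall n, exists alpha,
        t n * sup [set dist (x n) (C beta) | beta in [set: Omega]]
          <= dist (x n) (C alpha)
        /\ is_proj (C alpha) (x n) (x n.+1)].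

End Hilbert.
End Defs.

(* Main.v *)
(** Both directions compare the projection steps d_m = |x_m - x_(m+1)| with the
    sequence a_m of condition (T).

    Sufficiency. With q_m = |x_m - a|^2, quasi-symmetry bounds <x_m - x_(m+1), x_n - a>
    from below, and summation gives, for k <= n and some theta > 0,
      |x_k - x_n|^2 <= (1 + 1/theta) (q_k - q_n) + 2 (d_n / t_n) sum_(k <= m < n) d_m.
    The d_m are square summable, so (T) makes the last term small along a subsequence
    of n; since q_m converges, the x_k form a Cauchy sequence.

    Necessity. If (T) fails, then t_m <= C a_m sum_(l <= m) a_l from some index on. In l2
    take all hyperplanes orthogonal to a nonzero vector in a coordinate plane, which have
    only 0 in common, and start from a flat unit vector. The projection at time m either
    annihilates the two largest coordinates (when a_m is not small compared with the
    peak), or rotates a small amount of mass from a peak to a coordinate at most half as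
    large, by an angle proportional to a_m / peak. Rotations raise the l1 norm in
    proportion to a_m, while l1 norm * peak stays bounded, hence so does
    peak * sum_(l < m) a_l: this is what makes the rotations remote enough. Each step
    costs O(a_m^2) in the squared norm, which therefore does not tend to 0. *)
Require Import Defs.
From HB Require Import structures.
From mathcomp Require Import all_boot all_order all_algebra.
From mathcomp Require Import all_classical all_reals all_analysis.
From mathcomp Require Import ring lra.
Set Implicit Arguments.
Unset Strict Implicit.
Unset Printing Implicit Defensive.
Import Order.TTheory GRing.Theory Num.Theory.
Import numFieldNormedType.Exports.
Local Open Scope classical_set_scope.
Local Open Scope ring_scope.

(** * Real inner product spaces *)

Section Hilbert.
Variables (R : realType) (V : lmodType R) (ip : V -> V -> R).
Hypothesis H : is_real_hilbert ip.
Local Notation "`[ x ]" := (ipnorm ip x) (format "`[ x ]").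

Lemma ipC x y : ip x y = ip y x. Proof. by case: H. Qed.
Lemma ip_ge0 x : 0 <= ip x x. Proof. by case: H. Qed.

Lemma ip0l y : ip 0 y = 0.
Proof.
case: H => _ /(_ 1 0 0 y) + _ _ _.
by rewrite scale1r addr0 mul1r => h; apply: (@addrI _ (ip 0 y)); rewrite -h addr0.
Qed.

Lemma ipZl c x y : ip (c *: x) y = c * ip x y.
Proof. by case: H => _ h _ _ _; rewrite -[c *: x]addr0 h ip0l addr0. Qed.

Lemma ipDl x y z : ip (x + y) z = ip x z + ip y z.
Proof. by case: H => _ h _ _ _; rewrite -[x]scale1r h mul1r scale1r. Qed.

Lemma ipNl x y : ip (- x) y = - ip x y.
Proof. by rewrite -scaleN1r ipZl mulN1r. Qed.

Lemma ipBl x y z : ip (x - y) z = ip x z - ip y z.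
Proof. by rewrite ipDl ipNl. Qed.

Lemma ipZr c x y : ip y (c *: x) = c * ip y x.
Proof. by rewrite ipC ipZl ipC. Qed.

Lemma ipDr x y z : ip z (x + y) = ip z x + ip z y.
Proof. by rewrite ipC ipDl !(ipC z). Qed.

Lemma ipNr x y : ip y (- x) = - ip y x.
Proof. by rewrite ipC ipNl ipC. Qed.

Lemma ipBr x y z : ip z (x - y) = ip z x - ip z y.
Proof. by rewrite ipDr ipNr. Qed.

Definition ipE := (ipDl, ipDr, ipNl, ipNr, ipZl, ipZr).

Lemma ip_suml (I : Type) (s : seq I) (P : pred I) (f : I -> V) y :
  ip (\sum_(i <- s | P i) f i) y = \sum_(i <- s | P i) ip (f i) y.
Proof.
by apply: (big_morph (fun x => ip x y)) => [u v|]; rewrite ?ipDl ?ip0l.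
Qed.

Lemma ipnorm_ge0 x : 0 <= `[x]. Proof. exact: sqrtr_ge0. Qed.

Lemma sqr_ipnorm x : `[x] ^+ 2 = ip x x.
Proof. by rewrite sqr_sqrtr ?ip_ge0. Qed.

Lemma ipnormN x : `[- x] = `[x].
Proof. by rewrite /ipnorm ipNl ipNr opprK. Qed.

Lemma ipnormBC x y : `[x - y] = `[y - x].
Proof. by rewrite -ipnormN opprB. Qed.

Lemma cauchy_schwarz x y : `|ip x y| <= `[x] * `[y].
Proof.
rewrite -ler_sqr ?nnegrE ?mulr_ge0 ?ipnorm_ge0 //.
rewrite exprMn !sqr_ipnorm real_normK ?num_real //.
have := ip_ge0 y; rewrite le_eqVlt => /orP[/eqP y0|y0].
  have -> : y = 0 by case: H => _ _ _ h _; apply: h.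
  by rewrite ipC ip0l ip0l expr0n mulr0.
have := ip_ge0 (ip y y *: x - ip x y *: y).
rewrite !ipE (ipC y x) => h.
have : 0 <= ip y y * (ip x x * ip y y - ip x y ^+ 2) by apply: le_trans h _; lra.
by rewrite pmulr_rge0 // subr_ge0.
Qed.

Lemma ip_le x y : ip x y <= `[x] * `[y].
Proof. exact: le_trans (ler_norm _) (cauchy_schwarz x y). Qed.

Lemma ipnormD x y : `[x + y] <= `[x] + `[y].
Proof.
rewrite -ler_sqr ?nnegrE ?addr_ge0 ?ipnorm_ge0 //.
rewrite sqrrD !sqr_ipnorm ipDl !ipDr (ipC y x).
by have := ip_le x y; lra.
Qed.

Lemma ipnorm_triangle y x z : `[x - z] <= `[x - y] + `[y - z].
Proof. by apply: le_trans (ipnormD _ _); rewrite addrA subrK. Qed.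

Section Distance.
Variable A : set V.

Lemma has_inf_dist x y : A y -> has_inf [set `[x - y] | y in A].
Proof.
move=> Ay; split; first by exists `[x - y], y.
by exists 0 => _ [z _ <-]; exact: ipnorm_ge0.
Qed.

Lemma dist_le x y : A y -> dist ip x A <= `[x - y].
Proof.
move=> Ay; apply: ge_inf; last by exists y.
by exists 0 => _ [z _ <-]; exact: ipnorm_ge0.
Qed.

Lemma dist_ge0 x : 0 <= dist ip x A.
Proof.
have [->|/set0P[y Ay]] := eqVneq A set0; first by rewrite /dist image_set0 inf0.
apply: lb_le_inf; first by exists `[x - y], y.
by move=> _ [z _ <-]; exact: ipnorm_ge0.
Qed.

Lemma dist_approx x y e : A y -> 0 < e ->
  exists2 z, A z & `[x - z] < dist ip x A + e.
Proof.
move=> Ay e0; have [_ [z Az <-] h] := inf_adherent e0 (has_inf_dist x Ay).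
by exists z.
Qed.

Lemma dist_proj x p : is_proj ip A x p -> dist ip x A = `[x - p].
Proof.
move=> [Ap hp]; apply/eqP; rewrite eq_le dist_le //=.
apply: lb_le_inf; first by exists `[x - p], p.
by move=> _ [z Az <-]; exact: hp.
Qed.

(** Moving from [p] a fraction [s] towards [z] stays in [A] and cannot shorten the distance to [x].
    Expanding the square and dividing by [s] leaves an error [s * ip w w], which [s] is chosen to
    keep below [e]. *)
Lemma proj_obtuse x p z : convex_subset A -> is_proj ip A x p -> A z ->
  ip (x - p) (z - p) <= 0.
Proof.
move=> cA [Ap hp] Az; apply/ler_addgt0Pr => e e0; rewrite add0r.
set w := z - p; set d := x - p.
pose s := Num.min 1 (e / (ip w w + 1)).
have ww := ip_ge0 w.
have s0 : 0 < s by rewrite lt_min ltr01 divr_gt0 //; lra.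
have s1 : s <= 1 by rewrite ge_min lexx.
have se : s * ip w w <= e.
  have : s * (ip w w + 1) <= e by rewrite -ler_pdivlMr ?ge_min ?lexx ?orbT //; lra.
  lra.
have := hp _ (cA z p s Az Ap _); rewrite s1 ltW // => /(_ isT); rewrite -/d.
have -> : x - (s *: z + (1 - s) *: p) = d - s *: w.
  rewrite /d /w scalerBr scalerBl scale1r !opprD !opprK !addrA.
  by rewrite -!addrA; congr (_ + _); rewrite addrCA.
rewrite -ler_sqr ?nnegrE ?ipnorm_ge0 // !sqr_ipnorm.
clearbody w d; rewrite !ipE (ipC w d) => h.
have : s * (2 * ip d w) <= s * (s * ip w w) by lra.
by rewrite ler_pM2l // => h'; lra.
Qed.

End Distance.
End Hilbert.

(** * Series and condition (T) *)

Section RealSequences.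
Variable R : realType.
Implicit Types (u v t a : nat -> R) (m n N : nat).

Lemma nondecreasing_tail v B e : {homo v : m n / (m <= n)%N >-> m <= n} ->
  (forall n, v n <= B) -> 0 < e -> exists N, forall n, v n <= v N + e.
Proof.
move=> ndv vB e0.
have hs : has_sup (range v).
  by split; [exists (v 0%N), 0%N | exists B => _ [n _ <-]].
have [_ [N _ <-] hN] := sup_adherent e0 hs.
exists N => n; have : v n <= sup (range v) by apply: ub_le_sup; [case: hs | exists n].
by lra.
Qed.

Lemma nonneg_series_cvgP u : (forall n, 0 <= u n) ->
  cvgn (series u) <-> exists B, forall n, \sum_(0 <= k < n) u k <= B.
Proof.
move=> u0; split => [/cvg_has_ub[B hB]|[B hB]].
  exists B => n; apply: le_trans (ler_norm _) _; apply: hB.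
  by exists n.
apply: nondecreasing_is_cvgn; last by exists B => _ [n _ <-]; exact: hB.
by apply: nondecreasing_series => n _ _; exact: u0.
Qed.

Lemma le_sum_nat u m n : (forall k, 0 <= u k) -> (m <= n)%N ->
  \sum_(0 <= k < m) u k <= \sum_(0 <= k < n) u k.
Proof.
by move=> u0 mn; rewrite (big_cat_nat (leq0n m) mn) //= lerDl sumr_ge0.
Qed.

Lemma nonneg_series_tail u e : (forall n, 0 <= u n) -> cvgn (series u) -> 0 < e ->
  exists N, forall n, \sum_(N <= k < n) u k <= e.
Proof.
move=> u0 /(nonneg_series_cvgP u0)[B hB] e0.
have ndu : {homo (fun n => \sum_(0 <= k < n) u k) : m n / (m <= n)%N >-> m <= n}.
  by move=> m n; exact: le_sum_nat.
have [N hN] := nondecreasing_tail ndu hB e0.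
exists N => n; have [nN|/ltnW Nn] := leqP n N; first by rewrite big_geq // ltW.
have := hN n; rewrite (big_cat_nat (leq0n N) Nn) //=; lra.
Qed.

Lemma limn_einf_eq0P (f : nat -> \bar R) : (forall n, 0 <= f n)%E ->
  limn_einf f = 0%E <->
  forall e N, 0 < e -> exists2 n, (N <= n)%N & (f n < e%:E)%E.
Proof.
move=> f0; rewrite limn_einf_lim; split => [f_lim e N e0|h].
  have : (einfs f N <= 0)%E.
    rewrite -f_lim; apply: lime_ge; first exact: is_cvg_einfs.
    by exists N => // n Nn; exact: nondecreasing_einfs.
  move=> fN; have : (einfs f N < e%:E)%E by apply: le_lt_trans fN _; rewrite lte_fin.
  by move=> /ereal_inf_lt[_ [n Nn <-] fne]; exists n.
apply/eqP; rewrite eq_le; apply/andP; split.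
  apply/lee_addgt0Pr => e e0; rewrite add0e.
  apply: lime_le; first exact: is_cvg_einfs.
  exists 0%N => // N _; have [n Nn fne] := h e N e0.
  by apply: le_trans (ltW fne); apply: ereal_inf_lbound; exists n.
apply: lime_ge; first exact: is_cvg_einfs.
by exists 0%N => // N _; apply: le_ereal_inf_tmp => _ [n Nn <-].
Qed.

Section ConditionT.
Variables t a : nat -> R.
Hypothesis t0 : forall n, 0 <= t n.
Hypothesis a0 : forall n, (0 < n)%N -> 0 <= a n.

Let S m := \sum_(1 <= nu < m.+1) a nu.

Lemma condT_num_ge0 m : 0 <= a m * S m.
Proof.
case: m => [|m]; first by rewrite /S big_geq // mulr0.
by rewrite mulr_ge0 ?a0 // /S big_nat sumr_ge0 // => i /andP[/a0].
Qed.

Lemma condT_term_ge0 m : (0 <= condT_term t a m)%E.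
Proof.
rewrite /condT_term; case: ifP => _; first by case: ifP.
by rewrite lee_fin divr_ge0 // condT_num_ge0.
Qed.

(** Clearing the denominator confines the convention for [t m = 0] to the second disjunct. *)
Lemma condT_term_lt m e : 0 < e ->
  (condT_term t a m < e%:E)%E =
  (a m * S m < e * t m) || (t m == 0) && (a m * S m == 0).
Proof.
move=> e0; rewrite /condT_term -/(S m).
have := t0 m; rewrite le_eqVlt eq_sym; case: eqP => /= [->|_ tm].
  rewrite mulr0 [a m * S m < 0]ltNge condT_num_ge0 /=.
  by case: eqP => _; rewrite ?lte_fin ?e0.
by rewrite orbF lte_fin ltr_pdivrMr.
Qed.

End ConditionT.

(** With every [a n] positive the numerator cannot vanish at a positive index, which excludes terms
    that are 0 by convention. *)
Lemma condition_T_frequently t a e N :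
  (forall n, 0 <= t n) -> condition_T t -> (forall n, 0 < a n) -> in_l2 a -> 0 < e ->
  exists2 n, (N < n)%N & a n * \sum_(1 <= nu < n.+1) a nu < e * t n.
Proof.
move=> t0 hT a0 l2a e0; have a0' n : (0 < n)%N -> 0 <= a n by move=> _; exact: ltW.
have /(limn_einf_eq0P (condT_term_ge0 t0 a0'))/(_ e N.+1 e0)[n Nn] := hT _ a0' l2a.
rewrite condT_term_lt // => /orP[h|/andP[_ /eqP h]]; first by exists n.
have : 0 < a n * \sum_(1 <= nu < n.+1) a nu.
  case: n Nn {h} => // n _; rewrite mulr_gt0 // big_nat_recr //=.
  by apply: ltr_wpDl; rewrite ?a0 // sumr_ge0 // => i _; exact: ltW.
by rewrite h ltxx.
Qed.

Lemma not_condition_T t : (forall n, 0 <= t n) -> ~ condition_T t ->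
  exists a c N, [/\ forall n, (0 < n)%N -> 0 <= a n, in_l2 a, 0 < c &
    forall n, (N <= n)%N -> c * t n <= a n * \sum_(1 <= nu < n.+1) a nu].
Proof.
move=> t0 /existsNP[a /not_implyP[a0 /not_implyP[l2a]]].
move=> /(contra_not (limn_einf_eq0P (condT_term_ge0 t0 a0)).2).
move=> /existsNP[c /existsNP[N /not_implyP[c0 h]]].
exists a, c, N; split => // n Nn; rewrite leNgt; apply/negP => hn.
by apply: h; exists n; rewrite // condT_term_lt // hn.
Qed.

End RealSequences.

(** * Sufficiency of condition (T) *)

Lemma closed_set_approx (R : realType) (V : lmodType R) (ip : V -> V -> R)
    (A : set V) l :
  is_real_hilbert ip -> closed_set ip A ->
  (forall e, 0 < e -> exists2 z, A z & ipnorm ip (l - z) < e) -> A l.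
Proof.
move=> H cA h.
have /choice[z hz] : forall n : nat, exists z, A z /\ ipnorm ip (l - z) < n.+1%:R^-1.
  by move=> n; have [|z Az lz] := h n.+1%:R^-1; [rewrite invr_gt0 ltr0n|exists z].
apply: (cA z) => [n|e e0]; first by case: (hz n).
exists (Num.trunc e^-1) => n hn; rewrite ipnormBC //.
apply: lt_trans (hz n).2 _; rewrite -[e]invrK ltf_pV2 ?posrE ?invr_gt0 ?ltr0n //.
by apply: lt_le_trans (truncnS_gt _) _; rewrite ler_nat ltnS.
Qed.

Section RemoteProjectionsConverge.
Variables (R : realType) (V : lmodType R) (ip : V -> V -> R).
Hypothesis H : is_real_hilbert ip.
Local Notation "`[ x ]" := (ipnorm ip x) (format "`[ x ]").
Variables (Omega : Type) (C : Omega -> set V) (a : V) (t : nat -> R) (x : nat -> V).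
Variable al : nat -> Omega.
Hypothesis t0 : forall n, 0 <= t n.
Hypothesis closedC : forall be, closed_set ip (C be).
Hypothesis convexC : forall be, convex_subset (C be).
Hypothesis Ca : forall be, C be a.
Hypothesis qsC : unif_quasi_sym_wrt ip C a.
Hypothesis xP : forall n, is_proj ip (C (al n)) (x n) (x n.+1).
Hypothesis xR : forall n, t n * sup [set dist ip (x n) (C be) | be in [set: Omega]]
  <= dist ip (x n) (C (al n)).

Let d n := `[x n - x n.+1].
(** [2 * g n] is the cross term when [q n] is expanded around [x n.+1]. *)
Let g n := ip (x n - x n.+1) (x n.+1 - a).
Let q n := ip (x n - a) (x n - a).

Lemma step_ge0 n : 0 <= d n. Proof. exact: ipnorm_ge0. Qed.

Lemma step_ip_ge0 n : 0 <= g n.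
Proof.
have := proj_obtuse H (@convexC (al n)) (xP n) (Ca _).
by rewrite -(opprB (x n.+1) a) ipNr // oppr_le0.
Qed.

Lemma sqdist_step n : q n = q n.+1 + 2 * g n + d n ^+ 2.
Proof.
rewrite sqr_ipnorm // /g /q.
have -> : x n - a = (x n - x n.+1) + (x n.+1 - a) by rewrite addrA subrK.
move: (x n - x n.+1) (x n.+1 - a) => u v.
by rewrite !(ipE H) (ipC H v u); lra.
Qed.

Lemma sqdist_homo : {homo q : m n / (m <= n)%N >-> n <= m}.
Proof.
apply: homo_leq => [//|u v w|n]; first by move=> *; apply: le_trans; eassumption.
rewrite (sqdist_step n); have := step_ip_ge0 n; have := sqr_ge0 (d n); lra.
Qed.

Lemma anchor_dist_le n : `[x n - a] <= `[x 0%N - a].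
Proof.
by rewrite -ler_sqr ?nnegrE ?ipnorm_ge0 // !sqr_ipnorm // sqdist_homo.
Qed.

(** Remoteness controls the distance to every set of the family: the supremum is finite because each
    distance is at most [|x_n - a|]. *)
Lemma remote_dist_le n be : t n * dist ip (x n) (C be) <= d n.
Proof.
rewrite /d -(dist_proj (xP n)); apply: le_trans (xR n).
apply: ler_wpM2l => //; apply: ub_le_sup; last by exists be.
by exists `[x n - a] => _ [ga _ <-]; exact: dist_le.
Qed.

Lemma sum_sqr_step n : \sum_(0 <= k < n) d k ^+ 2 <= q 0%N - q n.
Proof.
elim: n => [|n IH]; first by rewrite big_geq // subrr.
by rewrite big_nat_recr //=; have := sqdist_step n; have := step_ip_ge0 n; lra.
Qed.

Lemma sum_step_ip k n : (k <= n)%N -> 2 * \sum_(k <= m < n) g m <= q k - q n.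
Proof.
move=> /subnKC <-; elim: (n - k)%N => [|j IH]; first by rewrite addn0 big_geq // subrr mulr0.
rewrite addnS big_nat_recr ?leq_addr //=.
by have := sqdist_step (k + j); have := sqr_ge0 (d (k + j)); lra.
Qed.

(* Reflecting a near point of x_n in C_(al m) through a gives an admissible test
   point for the projection at time m; this bounds <D_m, x_n - a> from below. *)
Lemma quasi_sym_step : exists2 th, 0 < th & forall m n,
  - (g m / th) - d m * dist ip (x n) (C (al m)) <= ip (x m - x m.+1) (x n - a).
Proof.
set rho := `[x 0%N - a]; have rho0 : 0 <= rho by exact: ipnorm_ge0.
(* The radius comes from [|z - a| <= |z - x_n| + |x_n - a| <= (rho + 1) + rho] for the near point
   [z] chosen below. *)
have [th [/andP[th0 _] hth]] := qsC (r := 2 * rho + 1) ltac:(lra).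
exists th => // m n; set de := dist _ _ _.
apply/ler_addgt0Pr => e e0.
have d0 := step_ge0 m.
pose ep := Num.min 1 (e / (d m + 1)).
have ep0 : 0 < ep by rewrite lt_min ltr01 divr_gt0 //; lra.
have ep1 : ep <= 1 by rewrite ge_min lexx.
have dep : d m * ep <= e.
  have : ep * (d m + 1) <= e by rewrite -ler_pdivlMr ?ge_min ?lexx ?orbT //; lra.
  lra.
have [z Cz xz] := dist_approx ip (x n) (Ca (al m)) ep0.
have xna := anchor_dist_le n.
have zr : `[z - a] <= 2 * rho + 1.
  have := ipnorm_triangle H (x n) z a; rewrite (ipnormBC H z (x n)).
  by have := dist_le ip (x n) (Ca (al m)); rewrite -/de -/rho in xz xna *; lra.
have Cza : C (al m) (a + (z - a)) by rewrite addrC subrK.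
have := proj_obtuse H (@convexC (al m)) (xP m) (hth _ _ Cza zr).
rewrite -/(g m).
have -> : a + - th *: (z - a) - x m.+1 = - th *: (z - a) - (x m.+1 - a).
  by rewrite opprB addrA (addrC _ a).
rewrite ipBr // ipZr // -/(g m) => obt.
have hz : - (g m / th) <= ip (x m - x m.+1) (z - a).
  by rewrite -mulNr ler_pdivrMr //; lra.
have -> : x n - a = (z - a) + (x n - z) by rewrite [RHS]addrC addrA subrK.
rewrite ipDr //.
have : - ip (x m - x m.+1) (x n - z) <= d m * (de + ep).
  rewrite -ipNr //; apply: le_trans (ip_le H _ _) _.
  by rewrite ipnormN //; apply: ler_wpM2l => //; exact: ltW.
lra.
Qed.

(** Polarisation gives [|x_k - x_n|^2 = q_k - q_n - 2 <x_k - x_n, x_n - a>]. The inner product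
    telescopes over the steps [m], each bounded by [quasi_sym_step], where remoteness at time [n]
    replaces the distance by [d n / t n]. *)
Lemma remote_sqdist_le : exists2 th, 0 < th & forall k n, (k <= n)%N -> 0 < t n ->
  `[x k - x n] ^+ 2 <=
    (1 + th^-1) * (q k - q n) + 2 * (d n / t n) * \sum_(k <= m < n) d m.
Proof.
have [th th0 hth] := quasi_sym_step; exists th => // k n kn tn.
have split_xk : x k - a = (x k - x n) + (x n - a) by rewrite addrA subrK.
have tele : x k - x n = \sum_(k <= m < n) (x m - x m.+1).
  rewrite -opprB -(telescope_sumr _ kn) -sumrN.
  by apply: eq_bigr => m _; rewrite opprB.
have : - ip (x k - x n) (x n - a) <=
    (\sum_(k <= m < n) g m) / th + d n / t n * \sum_(k <= m < n) d m.
  rewrite tele ip_suml // -sumrN mulr_suml mulr_sumr -big_split /=.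
  apply: ler_sum => m _.
  have := hth m n; have := remote_dist_le n (al m).
  rewrite mulrC -ler_pdivlMr // => /(ler_wpM2l (step_ge0 m)); lra.
have /(ler_wpM2r (ltW (_ : 0 < th^-1))) := sum_step_ip kn.
rewrite invr_gt0 th0 => /(_ isT) sg ipk.
rewrite sqr_ipnorm //.
have -> : ip (x k - x n) (x k - x n) = q k - q n - 2 * ip (x k - x n) (x n - a).
  rewrite {1}/q split_xk /q; move: (x k - x n) (x n - a) => u v.
  by rewrite !(ipE H) (ipC H v u); lra.
lra.
Qed.

(** One application of (T) yields both bounds at the same [n], once the partial sum is kept away
    from 0. *)
Lemma remote_frequently e N : condition_T t -> 0 < e ->
  exists n, [/\ (N < n)%N, 0 < t n, d n / t n <= e &
    d n / t n * \sum_(1 <= m < n) d m <= e].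
Proof.
move=> hT e0.
(* The geometric padding keeps [b] square summable, makes every term positive and forces the partial
   sums from index 1 to be at least [1/2]. *)
pose b n := d n + 2^-1 ^+ n.
have h0 n : 0 < 2^-1 ^+ n :> R by rewrite exprn_gt0 // invr_gt0.
have db n : d n <= b n by rewrite lerDl ltW.
have b0 n : 0 < b n by rewrite ltr_wpDl ?step_ge0.
have l2b : in_l2 b.
  apply/(nonneg_series_cvgP (fun n => sqr_ge0 (b n.+1))).
  exists (2 * q 0%N + 2) => n.
  have : \sum_(0 <= k < n) 2^-1 ^+ k.+1 = 1 - 2^-1 ^+ n :> R.
    elim: n => [|n IH]; first by rewrite big_geq // expr0 subrr.
    by rewrite big_nat_recr //= IH exprS; lra.
  have : \sum_(0 <= k < n) d k.+1 ^+ 2 <= q 0%N.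
    have := sum_sqr_step n.+1; rewrite big_nat_recl // => h.
    have := sqr_ge0 (d 0%N); have := ip_ge0 H (x n.+1 - a); rewrite -/(q _); lra.
  have : \sum_(0 <= k < n) b k.+1 ^+ 2 <=
      \sum_(0 <= k < n) (2 * d k.+1 ^+ 2 + 2 * 2^-1 ^+ k.+1).
    apply: ler_sum => k _; rewrite /b.
    have : 2^-1 ^+ k.+1 <= 1 :> R by rewrite exprn_ile1 ?invr_ge0 // invf_le1 // ler1n.
    have := h0 k.+1; move: (_ ^+ k.+1) (d k.+1) => u v u0 u1.
    have := sqr_ge0 (v - u); have : u ^+ 2 <= u by rewrite expr2 ler_piMr // ltW.
    lra.
  rewrite big_split /= -!mulr_sumr; have := h0 n; lra.
(* The halving compensates for the lower bound [1/2] on the partial sum. *)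
have e2 : 0 < e / 2 by rewrite divr_gt0.
have [n Nn hn] := condition_T_frequently N t0 hT b0 l2b e2.
set S := \sum_(1 <= nu < n.+1) b nu in hn.
have n0 : (0 < n)%N by exact: leq_ltn_trans Nn.
have S1 : 2^-1 <= S.
  rewrite /S big_ltn // -[leLHS]addr0; apply: lerD.
    by rewrite -[leLHS]expr1 lerDr step_ge0.
  by apply: sumr_ge0 => i _; exact: ltW.
have tn : 0 < t n.
  rewrite -(pmulr_rgt0 _ e2); apply: le_lt_trans hn.
  by rewrite mulr_ge0 ?(ltW (b0 n)) //; lra.
exists n; split => //.
  rewrite ler_pdivrMr //.
  have : b n * 2^-1 <= b n * S by apply: ler_wpM2l S1; exact: ltW.
  have := db n; lra.
rewrite mulrAC ler_pdivrMr //.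
have : d n * \sum_(1 <= m < n) d m <= b n * S.
  apply: ler_pM => //; [exact: step_ge0 | by apply: sumr_ge0 => i _; exact: step_ge0 |].
  rewrite /S big_nat_recr //= -[leLHS]addr0; apply: lerD; last exact: ltW.
  by apply: ler_sum => i _; exact: db.
have : 0 < e * t n by exact: mulr_gt0.
lra.
Qed.

(** Two late iterates are compared through a common later [x n], with [n] taken from the favourable
    subsequence. *)
Lemma remote_projections_cauchy : condition_T t -> seq_cauchy ip x.
Proof.
move=> hT e e0; have [th th0 hth] := remote_sqdist_le.
have c0 : 0 < 1 + th^-1 by rewrite ltr_pwDl // invr_ge0 ltW.
(* [r] is split in halves: one for the drop of [q], the other for [2 * (r / 4)] coming from (T). *)
pose r := (e / 4) ^+ 2.
have r0 : 0 < r by rewrite exprn_gt0 // divr_gt0.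
have [|||N hN] := @nondecreasing_tail _ (fun n => - q n) 0 (r / 2 / (1 + th^-1)).
- by move=> m n mn; rewrite lerN2 sqdist_homo.
- by move=> n; rewrite oppr_le0 ip_ge0.
- by rewrite !divr_gt0.
have near k n : (maxn 1 N <= k)%N -> (k <= n)%N -> 0 < t n ->
    d n / t n * \sum_(1 <= m < n) d m <= r / 4 -> `[x k - x n] <= e / 4.
  rewrite geq_max => /andP[k1 Nk] kn tn hn.
  rewrite -ler_sqr ?nnegrE ?ipnorm_ge0 //; last by rewrite divr_ge0 // ltW.
  apply: le_trans (hth _ _ kn tn) _; rewrite -/r.
  have : (1 + th^-1) * (q k - q n) <= r / 2.
    rewrite mulrC -ler_pdivlMr //; have := sqdist_homo Nk; have := hN n; lra.
  have : d n / t n * \sum_(k <= m < n) d m <= d n / t n * \sum_(1 <= m < n) d m.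
    apply: ler_wpM2l; first by rewrite divr_ge0 ?step_ge0.
    by rewrite (big_cat_nat k1 kn) /= lerDr sumr_ge0 // => i _; exact: step_ge0.
  lra.
exists (maxn 1 N) => k l hk hl.
have r4 : 0 < r / 4 by rewrite divr_gt0.
have [n [kln tn _ hn]] := remote_frequently (maxn k l) hT r4.
have /andP[kn ln] : (k <= n)%N && (l <= n)%N by rewrite -geq_max ltnW.
have := ipnorm_triangle H (x n) (x k) (x l); rewrite (ipnormBC H (x n)).
by have := near _ _ hk kn tn hn; have := near _ _ hl ln tn hn; lra.
Qed.

(** At favourable indices the distance from [x n] to every [C be] is at most [d n / t n], which is
    small, while [x n] is close to [l]. *)
Lemma remote_projections_limit l be :
  condition_T t -> seq_converges ip x l -> C be l.
Proof.
move=> hT xl; apply: (closed_set_approx H (@closedC be)) => e e0.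
have e3 : 0 < e / 3 by rewrite divr_gt0.
have [N hN] := xl _ e3.
have [n [Nn tn hn _]] := remote_frequently N hT e3.
have [z Cz xz] := dist_approx ip (x n) (Ca be) e3.
exists z => //; apply: le_lt_trans (ipnorm_triangle H (x n) _ _) _.
rewrite ipnormBC //; have := hN n (ltnW Nn).
have := remote_dist_le n be; rewrite mulrC -ler_pdivlMr //; lra.
Qed.

End RemoteProjectionsConverge.

Lemma remote_projections_converge (R : realType) (t : nat -> R)
    (V : lmodType R) (ip : V -> V -> R) (Omega : Type) (C : Omega -> set V)
    (a x0 : V) (x : nat -> V) :
  (forall n, 0 <= t n) -> condition_T t -> is_real_hilbert ip ->
  (forall al, closed_set ip (C al) /\ convex_subset (C al)) ->
  (forall al, C al a) -> unif_quasi_sym_wrt ip C a ->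
  remote_projections ip C t x0 x ->
  exists l, (forall al, C al l) /\ seq_converges ip x l.
Proof.
move=> t0 hT H cC Ca qs [_ _ /choice[al hal]].
have xP n := (hal n).2; have xR n := (hal n).1.
have cau := remote_projections_cauchy H t0 (fun be => (cC be).2) Ca qs xP xR hT.
case: (H) => _ _ _ _ /(_ _ cau)[l xl]; exists l; split=> // be.
exact: (remote_projections_limit H t0 (fun be => (cC be).1) (fun be => (cC be).2)
  Ca xP xR be hT xl).
Qed.

(** * The Hilbert space of square summable sequences *)

Section SquareSummable.
Variable R : realType.
Implicit Types (x y : nat -> R).

Definition sq_summable : {pred nat -> R} :=
  [pred x : nat -> R | `[< cvgn (series (fun n => x n ^+ 2)) >]].

Lemma sq_summableP x :
  reflect (exists B, forall n, \sum_(0 <= k < n) x k ^+ 2 <= B) (x \in sq_summable).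
Proof.
by apply: (iffP (asboolP _)) => /(nonneg_series_cvgP (fun n => sqr_ge0 (x n))).
Qed.

Lemma sq_summable_submod : submod_closed sq_summable.
Proof.
split=> [|c x y /sq_summableP[B hB] /sq_summableP[B' hB']]; apply/sq_summableP.
  by exists 0 => n; rewrite big1 // => i _; rewrite expr0n.
exists (2 * c ^+ 2 * B + 2 * B') => n.
apply: le_trans (_ : \sum_(0 <= k < n) (2 * c ^+ 2 * x k ^+ 2 + 2 * y k ^+ 2) <= _).
  apply: ler_sum => k _; rewrite fctE /=.
  change ((c * x k + y k) ^+ 2 <= 2 * c ^+ 2 * x k ^+ 2 + 2 * y k ^+ 2).
  by have := sqr_ge0 (c * x k - y k); lra.
rewrite big_split /= -!mulr_sumr.
have := ler_wpM2l (sqr_ge0 c) (hB n); have := hB' n; lra.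
Qed.

HB.instance Definition _ := GRing.isSubmodClosed.Build R (nat -> R) sq_summable
  sq_summable_submod.

Record ell2 := Ell2 { ell2_val :> nat -> R; _ : ell2_val \in sq_summable }.

HB.instance Definition _ := [isSub for ell2_val].
HB.instance Definition _ := [Choice of ell2 by <:].
HB.instance Definition _ := [SubChoice_isSubLmodule of ell2 by <:].

Lemma ell2P (x : ell2) : (x : nat -> R) \in sq_summable.
Proof. by case: x. Qed.

Lemma ell2_eqP (x y : ell2) : (forall k, x k = y k) -> x = y.
Proof. by move=> xy; apply: val_inj; apply/funext. Qed.

Definition ell2_ip (x y : ell2) : R := limn (series (fun k => x k * y k)).

(** Absolute convergence, from [|x_k y_k| <= x_k^2 + y_k^2]. *)
Lemma ell2_ip_cvg (x y : ell2) : cvgn (series (fun k => x k * y k)).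
Proof.
apply: normed_cvg; apply/(nonneg_series_cvgP (fun k => normr_ge0 (x k * y k))).
have /sq_summableP[B hB] := ell2P x; have /sq_summableP[B' hB'] := ell2P y.
exists (B + B') => n; apply: le_trans (lerD (hB n) (hB' n)).
rewrite -big_split /=; apply: ler_sum => k _; rewrite ler_norml.
have := sqr_ge0 (x k - y k); have := sqr_ge0 (x k + y k).
have := sqr_ge0 (x k); have := sqr_ge0 (y k); lra.
Qed.

Lemma ell2_ipC (x y : ell2) : ell2_ip x y = ell2_ip y x.
Proof. by rewrite /ell2_ip; under eq_fun do rewrite mulrC. Qed.

Lemma ell2_ip_linear c (x y z : ell2) :
  ell2_ip (c *: x + y) z = c * ell2_ip x z + ell2_ip y z.
Proof.
rewrite /ell2_ip.
have -> : series (fun k => (c *: x + y) k * z k) =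
    (fun n => c * series (fun k => x k * z k) n + series (fun k => y k * z k) n).
  apply/funext => n; rewrite /series /= mulr_sumr -big_split /=.
  apply: eq_bigr => k _.
  by change ((c * x k + y k) * z k = c * (x k * z k) + y k * z k); ring.
apply/cvg_lim => //; apply: cvgD; last exact: ell2_ip_cvg.
by apply: cvgMr; exact: ell2_ip_cvg.
Qed.

Lemma ell2_ip_ge (x : ell2) n : \sum_(0 <= k < n) x k ^+ 2 <= ell2_ip x x.
Proof.
have cx := @ell2_ip_cvg x x; rewrite /ell2_ip.
have sqrE : (fun k => x k * x k) = (fun k => x k ^+ 2) by apply/funext => k; rewrite expr2.
rewrite sqrE in cx *; apply: limr_ge => //; exists n => // m nm.
by apply: le_sum_nat => // k; exact: sqr_ge0.
Qed.

Lemma ell2_ip_le (x : ell2) B :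
  (forall n, \sum_(0 <= k < n) x k ^+ 2 <= B) -> ell2_ip x x <= B.
Proof.
move=> hB; apply: limr_le; first exact: ell2_ip_cvg.
exists 0%N => // n _; rewrite /series /=; apply: le_trans (hB n).
by apply: ler_sum => k _; rewrite expr2.
Qed.

Lemma ell2_ip_fsupp (x y : ell2) n : (forall k, (n <= k)%N -> x k = 0) ->
  ell2_ip x y = \sum_(0 <= k < n) x k * y k.
Proof.
move=> xn; apply/cvg_lim => //.
apply: cvg_near_cst; exists n => // m /= nm.
rewrite /series /= (big_cat_nat (leq0n n) nm) /= [X in _ + X]big_nat_cond.
by rewrite [X in _ + X]big1 ?addr0 // => k /andP[/andP[nk _] _]; rewrite xn ?mul0r.
Qed.

Lemma real_cauchy_converges (v : nat -> R) :
  (forall e, 0 < e -> exists N, forall m n, (N <= m)%N -> (N <= n)%N ->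
     `|v m - v n| < e) ->
  cvgn v.
Proof.
move=> hv; apply/cauchy_cvgP/cauchyP => e e0; have [N hN] := hv e e0.
exists (v N); exists N => // n Nn; rewrite /ball /=; exact: hN.
Qed.

Lemma ell2_hilbert : is_real_hilbert ell2_ip.
Proof.
split.
- exact: ell2_ipC.
- exact: ell2_ip_linear.
- by move=> x; have := ell2_ip_ge x 0; rewrite big_geq.
- move=> x x0; apply: ell2_eqP => k; change (x k = 0).
  have := ell2_ip_ge x k.+1; rewrite x0 big_nat_recr //= => h.
  have : 0 <= \sum_(0 <= i < k) x i ^+ 2 by apply: sumr_ge0 => i _; exact: sqr_ge0.
  have := sqr_ge0 (x k) => h1 h2.
  by apply/eqP; rewrite -sqrf_eq0 eq_le h1 andbT; lra.
move=> u cu.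
have ip0 (x : ell2) : 0 <= ell2_ip x x by have := ell2_ip_ge x 0; rewrite big_geq.
have cuk k : cvgn (fun n => u n k).
  apply: real_cauchy_converges => e e0; have [N hN] := cu e e0.
  exists N => m n Nm Nn; apply: le_lt_trans (hN m n Nm Nn).
  rewrite -sqrtr_sqr /ipnorm ler_wsqrtr //.
  apply: le_trans (ell2_ip_ge _ k.+1); rewrite big_nat_recr //=.
  by rewrite lerDr sumr_ge0 // => i _; exact: sqr_ge0.
pose l k := limn (fun n => u n k).
(* The Cauchy bound holds for every finite partial sum, uniformly in [K], so it survives the
   coordinatewise limit. *)
have tail e : 0 < e -> exists N, forall m, (N <= m)%N ->
    forall K, \sum_(0 <= k < K) (u m k - l k) ^+ 2 <= e ^+ 2.
  move=> e0; have [N hN] := cu e e0; exists N => m Nm K.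
  have cK : (fun n => \sum_(0 <= k < K) (u m k - u n k) ^+ 2) @ \oo -->
      \sum_(0 <= k < K) (u m k - l k) ^+ 2.
    elim: K => [|K IH].
      by under eq_fun do rewrite big_geq //; rewrite big_geq //; exact: cvg_cst.
    rewrite big_nat_recr //=; under eq_fun do rewrite big_nat_recr //=.
    by apply: cvgD => //; rewrite expr2; apply: cvgM; apply: cvgB; first
      [exact: cvg_cst | exact: cuk].
  rewrite -(cvg_lim _ cK) //; apply: limr_le; first by apply/cvg_ex; eexists; exact: cK.
  exists N => // n Nn; apply: le_trans (ell2_ip_ge (u m - u n) K) _.
  rewrite -[leLHS]sqr_sqrtr // ler_sqr ?nnegrE ?sqrtr_ge0 // ?ltW //.
  exact: hN.
have lP : l \in sq_summable.
  have [N hN] := tail 1 ltr01.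
  have dP : (fun k => u N k - l k) \in sq_summable.
    by apply/sq_summableP; exists (1 ^+ 2) => n; exact: hN.
  (* [l] differs from a member of the space by a square summable sequence. *)
  have -> : l = (u N : nat -> R) - (fun k => u N k - l k).
    by apply/funext => k; rewrite fctE /= opprB addrC subrK.
  by apply: rpredB => //; exact: ell2P.
exists (Ell2 lP) => e e0; have e2 : 0 < e / 2 by rewrite divr_gt0.
have [N hN] := tail _ e2; exists N => n Nn.
apply: le_lt_trans (_ : e / 2 < e); last lra.
rewrite -(ger0_norm (ltW e2)) -sqrtr_sqr; apply: ler_wsqrtr.
by apply: ell2_ip_le => K; exact: hN.
Qed.

End SquareSummable.

(** * Finitely supported sequences and plane rotations *)

(* [(a, b)] is the projection of [(u, v)] onto the orthogonal complement of
   [(v + s u, s v - u)]; for [s] small it moves mass from [u] to [v], so that the l1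
   norm grows to first order in [s] while the l2 norm drops only to second order. *)
Lemma plane_rotation (R : realType) (u v s : R) :
  0 < u -> 0 <= v -> 2 * v <= u -> 0 <= s -> 10 * s <= 1 ->
  let a := (u - s * v) / (1 + s ^+ 2) in let b := (v + s * u) / (1 + s ^+ 2) in
  [/\ u <= 2 * a /\ a <= u, 0 <= b <= u,
      3 / 10 * (s * u) <= a + b - u - v &
      0 <= u ^+ 2 + v ^+ 2 - (a ^+ 2 + b ^+ 2) <= 2 * (s * u) ^+ 2].
Proof.
set c := 1 + s ^+ 2 => u0 v0 vu s0 s1 a b.
have c1 : 1 <= c by rewrite lerDl sqr_ge0.
have c0 : 0 < c by exact: lt_le_trans c1.
have ac : c * a = u - s * v by rewrite mulrC divfK // gt_eqF.
have bc : c * b = v + s * u by rewrite mulrC divfK // gt_eqF.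
have aE : a = u - s * b.
  by apply: (mulfI (lt0r_neq0 c0)); rewrite ac mulrBr mulrCA bc /c; ring.
have bE : b = v + s * a.
  by apply: (mulfI (lt0r_neq0 c0)); rewrite bc mulrDr mulrCA ac /c; ring.
have c2 : 100 * c <= 101 by rewrite /c expr2; have := ler_wpM2l s0 s1; lra.
have cu1 := ler_wpM2r (ltW u0) c1; have cu2 := ler_wpM2r (ltW u0) c2.
have sv := ler_wpM2l s0 vu; have sv0 := mulr_ge0 s0 v0.
have su := ler_wpM2r (ltW u0) s1; have su0 := mulr_ge0 s0 (ltW u0).
clearbody a b c.
have a_le : a <= u by rewrite -(ler_pM2l c0) ac; lra.
have a_ge : u <= 2 * a by rewrite -(ler_pM2l c0) mulrCA ac; lra.
have b_ge : 0 <= b by rewrite -(ler_pM2l c0) bc; lra.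
have b_le : b <= u by rewrite -(ler_pM2l c0) bc; lra.
split; rewrite ?b_ge //.
  (* By [aE] and [bE] the gain in l1 norm is exactly [s * (a - b)]. *)
  have h : 3 / 10 * u <= a - b by rewrite -(ler_pM2l c0) mulrBr ac bc; lra.
  have := ler_wpM2l s0 h; lra.
(* The loss is exactly [s^2] times the new squared norm, and both new coordinates are at most
   [u]. *)
have -> : u ^+ 2 + v ^+ 2 - (a ^+ 2 + b ^+ 2) = s ^+ 2 * (a ^+ 2 + b ^+ 2).
  have -> : u = a + s * b by rewrite aE subrK.
  have -> : v = b - s * a by rewrite {1}bE addrK.
  by ring.
rewrite mulr_ge0 ?addr_ge0 ?sqr_ge0 //= exprMn mulrCA ler_wpM2l ?sqr_ge0 //.
have : a ^+ 2 <= u ^+ 2 by rewrite ler_sqr ?nnegrE; lra.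
have : b ^+ 2 <= u ^+ 2 by rewrite ler_sqr ?nnegrE; lra.
lra.
Qed.

Section FiniteSupport.
Variable R : realType.
Implicit Types (x y : nat -> R) (P : pred nat).

Definition update x p u : nat -> R := fun k => if k == p then u else x k.

Lemma sum_update (f : R -> R) x p u n : (p < n)%N ->
  \sum_(0 <= k < n) f (update x p u k) = \sum_(0 <= k < n) f (x k) - f (x p) + f u.
Proof.
move=> pn; rewrite !big_mkord [LHS](bigD1 (Ordinal pn)) //=.
rewrite [in RHS](bigD1 (Ordinal pn)) //= /update eqxx.
rewrite (eq_bigr (fun k : 'I_n => f (x k))); first by ring.
by move=> k; rewrite -val_eqE /= => /negbTE ->.
Qed.

Definition update2 x p q u v := update (update x q v) p u.

Lemma sum_update2 (f : R -> R) x p q u v n : p != q -> (p < n)%N -> (q < n)%N ->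
  \sum_(0 <= k < n) f (update2 x p q u v k) =
  \sum_(0 <= k < n) f (x k) - f (x p) - f (x q) + f u + f v.
Proof.
by move=> pq pn qn; rewrite !sum_update // {1}/update (negbTE pq); ring.
Qed.

(** If [k0] is not already a maximiser, some [k1] has a positive value exceeding it; all values
    beyond some [N] are smaller than [y k1], so the maximum is over a finite range. *)
Lemma vanishing_argmax y P : (forall k, 0 <= y k) ->
  (forall e, 0 < e -> exists N, forall k, (N <= k)%N -> y k < e) ->
  (exists k, P k) -> exists2 q, P q & forall k, P k -> y k <= y q.
Proof.
move=> y0 y_lim [k0 Pk0].
have [h|/existsNP[k1 /not_implyP[Pk1 /negP]]] := EM (forall k, P k -> y k <= y k0).
  by exists k0.
rewrite -ltNge => yk01; have yk1 : 0 < y k1 by exact: le_lt_trans yk01.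
have [N hN] := y_lim _ yk1.
have k1N : (k1 < N)%N by rewrite ltnNge; apply/negP => /hN; rewrite ltxx.
case: (@Order.TotalTheory.arg_maxP _ _ _ (Ordinal k1N) (fun k : 'I_N => P k)
  (fun k : 'I_N => y k) Pk1) => q Pq hq.
exists q => // k Pk; have [kN|Nk] := ltnP k N; first exact: (hq (Ordinal kN)).
exact: le_trans (ltW (hN _ Nk)) (hq (Ordinal k1N) Pk1).
Qed.

Definition vanish_from x n := forall k, (n <= k)%N -> x k = 0.

Lemma vanish_from_argmax x n P : (forall k, 0 <= x k) -> vanish_from x n ->
  (exists k, P k) -> exists2 q, P q & forall k, P k -> x k <= x q.
Proof.
by move=> x0 xn; apply: vanishing_argmax => // e e0; exists n => k /xn ->.
Qed.

Lemma sum_vanish_from (f : R -> R) x m n : f 0 = 0 -> vanish_from x m -> (m <= n)%N ->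
  \sum_(0 <= k < n) f (x k) = \sum_(0 <= k < m) f (x k).
Proof.
move=> f0 xm mn; rewrite (big_cat_nat (leq0n m) mn) /= [X in _ + X]big_nat_cond.
by rewrite [X in _ + X]big1 ?addr0 // => k /andP[/andP[mk _] _]; rewrite xm.
Qed.

End FiniteSupport.

(** * A mass-spreading sequence of planar projections *)

Section Dynamics.
Variable R : realType.
Implicit Types (x y : nat -> R) (tau delta : R).

(** Coefficient along the normal [w1 e_p + w2 e_q] in the orthogonal projection onto its hyperplane,
    which is [plane_proj]. *)
Definition plane_lam x p q w1 w2 : R :=
  (w1 * x p + w2 * x q) / (w1 ^+ 2 + w2 ^+ 2).

Definition plane_proj x p q w1 w2 : nat -> R :=
  update2 x p q (x p - plane_lam x p q w1 w2 * w1) (x q - plane_lam x p q w1 w2 * w2).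

(* The inequality is remoteness: [w] in the coordinate plane (p, q) has
   dist(x, w^perp) = |<x, w>| / |w|, and the supremum over all [w] supported on the
   plane (k, l) is sqrt(x_k^2 + x_l^2). *)
Definition plane_step tau x y := exists p q w1 w2,
  [/\ p != q, 0 < w1 ^+ 2 + w2 ^+ 2, y = plane_proj x p q w1 w2 &
    forall k l, k != l ->
      tau ^+ 2 * (x k ^+ 2 + x l ^+ 2) * (w1 ^+ 2 + w2 ^+ 2) <=
      (w1 * x p + w2 * x q) ^+ 2].

Variables (b : nat -> R).

Let B1 m := \sum_(0 <= l < m) b l.
Let B2 m := \sum_(0 <= l < m) b l ^+ 2.

(* [i] is a peak; [j] is the only coordinate allowed strictly between 0 and half the
   peak, so that [peak * l1 norm <= 3 * l2 norm ^ 2]. *)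
Definition state_inv delta m x := exists n i j,
  [/\ vanish_from x n, forall k, 0 <= x k <= x i, x i <= delta &
   [/\ forall k, k != j -> x k = 0 \/ x i <= 2 * x k,
      x i * (3 / 5 * B1 m - \sum_(0 <= k < n) x k) <= 812 * B2 m &
      1 - 800 * B2 m <= \sum_(0 <= k < n) x k ^+ 2 <= 1]].

Lemma vanish_from_le x m n : (m <= n)%N -> vanish_from x m -> vanish_from x n.
Proof. by move=> mn xm k nk; apply: xm; exact: leq_trans nk. Qed.

(** Bookkeeping common to both kinds of step: since no coordinate rises above the old peak, only the
    local changes of the l1 and l2 norms remain to be checked. *)
Lemma state_inv_update delta m x n i j p q u v :
  0 <= b m ->
  vanish_from x n -> (forall k, 0 <= x k <= x i) -> x i <= delta ->
  x i * (3 / 5 * B1 m - \sum_(0 <= k < n) x k) <= 812 * B2 m ->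
  1 - 800 * B2 m <= \sum_(0 <= k < n) x k ^+ 2 <= 1 ->
  p != q -> (p < n)%N -> (q < n)%N -> 0 <= u <= x i -> 0 <= v <= x i ->
  (forall k, k != j -> update2 x p q u v k = 0 \/ x i <= 2 * update2 x p q u v k) ->
  x i * (3 / 5 * b m + x p + x q - u - v) <= 812 * b m ^+ 2 ->
  0 <= x p ^+ 2 + x q ^+ 2 - (u ^+ 2 + v ^+ 2) <= 800 * b m ^+ 2 ->
  state_inv delta m.+1 (update2 x p q u v).
Proof.
move=> bm xn xi xid hl1 hl2 pq pn qn hu hv hj hb1 hb2.
set y := update2 x p q u v in hj *.
have yn : vanish_from y n.
  move=> k nk; rewrite /y /update2 /update !ifN ?xn //.
    by apply: contraTneq nk => ->; rewrite -ltnNge.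
  by apply: contraTneq nk => ->; rewrite -ltnNge.
have yi k : 0 <= y k <= x i.
  by rewrite /y /update2 /update; case: ifP => // _; case: ifP.
have [i' _ hi'] := vanish_from_argmax (P := predT) (fun k => proj1 (andP (yi k))) yn
  (ex_intro _ 0%N isT).
have /andP[y0 yxi] := yi i'.
have sy : \sum_(0 <= k < n) y k = \sum_(0 <= k < n) x k - x p - x q + u + v.
  exact: (sum_update2 id).
have sy2 : \sum_(0 <= k < n) y k ^+ 2 =
    \sum_(0 <= k < n) x k ^+ 2 - x p ^+ 2 - x q ^+ 2 + u ^+ 2 + v ^+ 2.
  exact: (sum_update2 (fun r => r ^+ 2)).
have B1S : B1 m.+1 = B1 m + b m by rewrite /B1 big_nat_recr.
have B2S : B2 m.+1 = B2 m + b m ^+ 2 by rewrite /B2 big_nat_recr.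
exists n, i', j; split => //; [|exact: le_trans xid|split].
- by move=> k; have /andP[-> _] := yi k; exact: hi'.
- by move=> k /hj[->|h]; [left|right; exact: le_trans h].
- have B20 : 0 <= B2 m.+1 by apply: sumr_ge0 => k _; exact: sqr_ge0.
  rewrite sy; set W := _ - _.
  (* The new peak may be smaller than the old one; this can only help when the l1 deficit [W] is
     positive, and a nonpositive [W] is harmless. *)
  have [W0|/ltW W0] := leP W 0.
    by apply: (@le_trans _ _ 0); [exact: mulr_ge0_le0 y0 W0 | exact: mulr_ge0 (ler0n _ _) B20].
  apply: le_trans (ler_wpM2r W0 yxi) _; rewrite /W B1S B2S.
  by clear -hl1 hb1; lra.
- by rewrite sy2 B2S; move: hl2 hb2 => /andP[? ?] /andP[? ?]; apply/andP; split; lra.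
Qed.

(** Off [j] one has [x_i x_k <= 2 x_k^2], and at [j] one has [x_i x_j <= 2 x_j^2 + x_i^2 / 8];
    summing gives at most [2 + 1/8]. The peak is positive because the squared norm is. *)
Lemma state_inv_peak m x n i j :
  812 * B2 m <= 2^-1 -> (forall k, 0 <= x k <= x i) ->
  (forall k, k != j -> x k = 0 \/ x i <= 2 * x k) ->
  1 - 800 * B2 m <= \sum_(0 <= k < n) x k ^+ 2 <= 1 -> vanish_from x n ->
  0 < x i /\ x i * \sum_(0 <= k < n) x k <= 3.
Proof.
move=> hB2 xi hj /andP[l2lo l2hi] xn.
have B20 : 0 <= B2 m by apply: sumr_ge0 => k _; exact: sqr_ge0.
have /andP[xi0 _] := xi i.
have in_n : (i < n)%N \/ x i = 0 by have [/xn|] := leqP n i; [right|left].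
have xi_pos : 0 < x i.
  rewrite lt_neqAle xi0 andbT eq_sym; apply/eqP => xiz.
  have : \sum_(0 <= k < n) x k ^+ 2 = 0.
    rewrite big1 // => k _; have := xi k; rewrite xiz => /le_anti <-.
    by rewrite expr0n.
  lra.
split => //.
have xi_l2 : x i ^+ 2 <= \sum_(0 <= k < n) x k ^+ 2.
  case: in_n => [ni|->]; last by rewrite expr0n sumr_ge0 // => k _; exact: sqr_ge0.
  rewrite big_mkord (bigD1 (Ordinal ni)) //= lerDl sumr_ge0 // => k _; exact: sqr_ge0.
have : x i * \sum_(0 <= k < n) x k <=
    2 * \sum_(0 <= k < n) x k ^+ 2 + \sum_(0 <= k < n) (if k == j then x i ^+ 2 / 8 else 0).
  rewrite !mulr_sumr -big_split /=; apply: ler_sum => k _.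
  have /andP[xk0 _] := xi k.
  case: eqP => [_|/eqP /hj[->|h]]; last by have := ler_wpM2r xk0 h; lra.
    have := sqr_ge0 (x k - x i / 4); lra.
  by rewrite !mulr0 expr0n mulr0 addr0.
have : \sum_(0 <= k < n) (if k == j then x i ^+ 2 / 8 else 0) <= x i ^+ 2 / 8.
  rewrite -big_mkcond big_nat1_eq; case: ifP => _; have := sqr_ge0 (x i); lra.
lra.
Qed.

Lemma two_largest_le y i q k l : (forall k, y k <= y i) ->
  (forall k, k != i -> y k <= y q) -> k != l -> y k + y l <= y i + y q.
Proof.
move=> yi yq kl; have [ki|ki] := eqVneq k i.
  by rewrite ki lerD // yq // -ki eq_sym.
by rewrite addrC lerD // yq.
Qed.

(** The normal is the restriction of [x] to its two largest coordinates [i] and [q]. Projecting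
    annihilates both and realises the largest planar distance, so the step is remote for every
    [tau <= 1]. *)
Lemma step_kill tau delta m x :
  0 <= tau <= 1 -> 0 <= b m -> 812 * B2 m <= 2^-1 -> state_inv delta m x ->
  (forall k, x k <= 20 * b m) ->
  exists2 y, state_inv delta m.+1 y & plane_step tau x y.
Proof.
move=> /andP[tau0 tau1] bm hB2 [n [i [j [xn xi xid [hj hl1 hl2]]]]] xb.
have [xi0 _] := state_inv_peak hB2 xi hj hl2 xn.
have x0 k : 0 <= x k by have /andP[] := xi k.
have [q qi hq] := vanish_from_argmax (P := fun k => k != i) x0 xn
  (ex_intro _ i.+1 (negbT (gtn_eqF (ltnSn i)))).
(* [i] and [q] may lie beyond the support bound [n], so the summation range is enlarged. *)
pose N := (n + i + q).+1.
have nN : (n <= N)%N by rewrite /N -addnA leqW // leq_addr.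
have iN : (i < N)%N by rewrite /N ltnS addnAC leq_addl.
have qN : (q < N)%N by rewrite /N ltnS leq_addl.
pose W := x i ^+ 2 + x q ^+ 2.
have W0 : 0 < W by rewrite ltr_pwDl ?exprn_gt0 ?sqr_ge0.
have projE : plane_proj x i q (x i) (x q) = update2 x i q 0 0.
  by rewrite /plane_proj /plane_lam -!expr2 divff ?gt_eqF // !mul1r !subrr.
have sums (f : R -> R) : f 0 = 0 ->
    \sum_(0 <= k < n) f (x k) = \sum_(0 <= k < N) f (x k).
  by move=> f0; rewrite (sum_vanish_from f0 xn nN).
exists (update2 x i q 0 0).
  apply: (state_inv_update (n := N) (i := i) (j := j) bm (vanish_from_le nN xn)) => //.
  - by rewrite -(sums id).
  - by rewrite -(sums (fun r => r ^+ 2)) // expr0n.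
  - by rewrite eq_sym.
  - by rewrite lexx x0.
  - by rewrite lexx x0.
  - move=> k kj; rewrite /update2 /update; case: ifP => _; first by left.
    by case: ifP => _; [left | exact: hj].
  (* This case fixes the constants of the invariant: [20 * (3/5 + 20 + 20) = 812] here, and
     [2 * 20^2 = 800] for the l2 loss. *)
  - have := xb i; have := xb q; rewrite !subr0 => h1 h2.
    apply: le_trans (_ : 20 * b m * (3 / 5 * b m + 20 * b m + 20 * b m) <= _); last lra.
    by apply: ler_pM; [exact: x0 | have := x0 i; have := x0 q; lra | exact: h2 | lra].
  - have sq k : x k ^+ 2 <= (20 * b m) ^+ 2 by rewrite ler_sqr ?nnegrE ?x0 ?mulr_ge0.
    rewrite expr0n /= addr0 subr0 (ltW W0) /=; have := sq i; have := sq q; lra.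
exists i, q, (x i), (x q); split => //; first by rewrite eq_sym.
move=> k l kl; rewrite -!expr2 -/W [leRHS]expr2; apply: ler_wpM2r; first exact: ltW.
have hkl : x k ^+ 2 + x l ^+ 2 <= W.
  apply: (@two_largest_le (fun k => x k ^+ 2)) kl => [h|h hi].
    by rewrite ler_sqr ?nnegrE ?x0 //; have /andP[] := xi h.
  by rewrite ler_sqr ?nnegrE ?x0 ?hq.
have t1 : tau ^+ 2 <= 1 by rewrite expr_le1.
apply: le_trans (ler_pM (sqr_ge0 tau) _ t1 hkl) _; last by rewrite mul1r.
by rewrite addr_ge0 ?sqr_ge0.
Qed.

(** Mass moves from the peak [i] to a coordinate [q]. The invariant bounds [peak * B1], so the
    rotation parameter [s], of order [b m / peak], dominates [tau]. *)
Lemma step_rotate tau delta Bc m x :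
  0 <= tau -> 0 <= b m -> 0 <= Bc -> Bc * delta <= 1 -> delta <= 1 ->
  812 * B2 m <= 2^-1 -> state_inv delta m x ->
  15 * tau <= b m * (Bc + B1 m.+1) ->
  (exists k, 20 * b m <= x k) ->
  exists2 y, state_inv delta m.+1 y & plane_step tau x y.
Proof.
move=> tau0 bm Bc0 Bcd d1 hB2 [n [i [j [xn xi xid [hj hl1 hl2]]]]] htau [k0 xk0].
have [xi0 hM] := state_inv_peak hB2 xi hj hl2 xn.
have x0 k : 0 <= x k by have /andP[] := xi k.
have bxi : 20 * b m <= x i by apply: le_trans xk0 _; have /andP[] := xi k0.
(* If [x j] is at most half the peak, mass goes there; otherwise [j] is no longer exceptional and a
   fresh zero coordinate takes its place. *)
have [q [qi xq hq]] : exists q, [/\ q != i, 2 * x q <= x i &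
    forall k, k != q -> x k = 0 \/ x i <= 2 * x k].
  have [xj|xj] := leP (2 * x j) (x i).
    by exists j; split => //; apply: contraTneq xj => ->; rewrite -ltNge; lra.
  exists (n + i).+1; split.
  - by rewrite gtn_eqF // ltnS leq_addl.
  - by rewrite xn ?mulr0 ?ltW // leqW // leq_addr.
  by move=> k _; have [->|/hj //] := eqVneq k j; right; exact: ltW.
pose N := (n + i + q).+1.
have nN : (n <= N)%N by rewrite /N -addnA leqW // leq_addr.
have iN : (i < N)%N by rewrite /N ltnS addnAC leq_addl.
have qN : (q < N)%N by rewrite /N ltnS leq_addl.
(* The factor 2 makes the l1 gain [3/10 * (2 * b m)], matching the [3/5] of the invariant;
   [20 * b m <= x i] gives [s <= 1/10]. *)
pose s := 2 * b m / x i.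
have sxi : s * x i = 2 * b m by rewrite divfK // gt_eqF.
have s0 : 0 <= s by rewrite divr_ge0 ?mulr_ge0 // ltW.
have s1 : 10 * s <= 1 by rewrite -(ler_pM2r xi0) -mulrA sxi; lra.
have := plane_rotation xi0 (x0 q) xq s0 s1.
set u := (x i - s * x q) / (1 + s ^+ 2); set v := (x q + s * x i) / (1 + s ^+ 2).
move=> [[u_ge u_le] v_bd gain loss].
rewrite sxi in gain loss.
have projE : plane_proj x i q (x q + s * x i) (s * x q - x i) = update2 x i q u v.
  rewrite /plane_proj; have -> : plane_lam x i q (x q + s * x i) (s * x q - x i) = s / (1 + s ^+ 2).
    rewrite /plane_lam.
    have -> : (x q + s * x i) * x i + (s * x q - x i) * x q = s * (x i ^+ 2 + x q ^+ 2) by ring.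
    have -> : (x q + s * x i) ^+ 2 + (s * x q - x i) ^+ 2 =
      (1 + s ^+ 2) * (x i ^+ 2 + x q ^+ 2) by ring.
    rewrite -mulf_div divff ?mulr1 // gt_eqF // ltr_pwDl ?exprn_gt0 ?sqr_ge0 //.
  have c0 : 1 + s ^+ 2 != 0 by rewrite gt_eqF // ltr_pwDl ?sqr_ge0.
  by congr update2; rewrite /u /v; field.
have sums (f : R -> R) : f 0 = 0 ->
    \sum_(0 <= k < n) f (x k) = \sum_(0 <= k < N) f (x k).
  by move=> f0; rewrite (sum_vanish_from f0 xn nN).
exists (update2 x i q u v).
  (* The donor [i] keeps at least half the old peak, so [q] is the only exceptional coordinate
     afterwards. *)
  apply: (state_inv_update (n := N) (i := i) (j := q) bm (vanish_from_le nN xn)) => //.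
  - by rewrite -(sums id).
  - by rewrite -(sums (fun r => r ^+ 2)) // expr0n.
  - by rewrite eq_sym.
  - by rewrite u_le andbT; lra.
  - move=> k kq; rewrite /update2 /update (negbTE kq); case: eqP => _; first by right.
    exact: hq.
  - apply: (@le_trans _ _ 0); last exact: mulr_ge0 (ler0n _ _) (sqr_ge0 _).
    by apply: mulr_ge0_le0; [exact: ltW | lra].
  - by move: loss => /andP[-> h]; apply: le_trans h _; have := sqr_ge0 (b m); lra.
exists i, q, (x q + s * x i), (s * x q - x i); split => //.
- by rewrite eq_sym.
- have -> : (x q + s * x i) ^+ 2 + (s * x q - x i) ^+ 2 =
      (1 + s ^+ 2) * (x i ^+ 2 + x q ^+ 2) by ring.
  by rewrite mulr_gt0 // ltr_pwDl ?exprn_gt0 ?sqr_ge0.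
move=> k l _.
have -> : (x q + s * x i) ^+ 2 + (s * x q - x i) ^+ 2 =
      (1 + s ^+ 2) * (x i ^+ 2 + x q ^+ 2) by ring.
have -> : (x q + s * x i) * x i + (s * x q - x i) * x q = s * (x i ^+ 2 + x q ^+ 2) by ring.
set W := x i ^+ 2 + x q ^+ 2.
have W0 : 0 <= W by rewrite addr_ge0 ?sqr_ge0.
(* With [x i * Bc <= 1] and [x i * B1 m.+1 <= 6], the hypothesis gives
   [15 * tau * x i <= 7 * b m]. *)
have tau_s : 2 * tau <= s.
  rewrite -(ler_pM2r xi0) sxi.
  have hB1 : x i * B1 m.+1 <= 6.
    have -> : B1 m.+1 = B1 m + b m by rewrite /B1 big_nat_recr.
    have : x i * b m <= 1 * b m by apply: ler_wpM2r => //; exact: le_trans d1.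
    lra.
  have hBc : x i * Bc <= 1 by apply: le_trans Bcd; rewrite mulrC ler_wpM2l.
  have := ler_wpM2l (ltW xi0) htau.
  have := ler_wpM2l bm (lerD hBc hB1); lra.
have sq h : x h ^+ 2 <= x i ^+ 2.
  by rewrite ler_sqr ?nnegrE ?x0 //; have /andP[] := xi h.
have s2 : s ^+ 2 <= 1 by rewrite expr_le1 //; lra.
have tau2 : 4 * tau ^+ 2 <= s ^+ 2.
  have -> : 4 * tau ^+ 2 = (2 * tau) ^+ 2 by ring.
  by rewrite ler_sqr ?nnegrE // mulr_ge0.
rewrite mulrA [leRHS](_ : _ = s ^+ 2 * W * W); last by ring.
apply: ler_wpM2r => //.
(* Any two squared coordinates sum to at most [2 * W], and [1 + s^2 <= 2]. *)
apply: le_trans (_ : tau ^+ 2 * (2 * W) * 2 <= _).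
  apply: ler_pM; [by rewrite mulr_ge0 ?addr_ge0 ?sqr_ge0 | by rewrite addr_ge0 ?sqr_ge0 | | lra].
  apply: ler_wpM2l; first exact: sqr_ge0.
  have := sq k; have := sq l; have := sqr_ge0 (x q); rewrite /W; lra.
by have := ler_wpM2r W0 tau2; lra.
Qed.

(** [N^2] entries of size [1/N]: the norm is 1 while the peak is as small as desired. *)
Definition block_state (N k : nat) : R := if (k < N * N)%N then N%:R^-1 else 0.

Lemma state_inv_block N : (0 < N)%N -> state_inv N%:R^-1 0 (block_state N).
Proof.
move=> N0; have NN0 : (0 < N * N)%N by rewrite muln_gt0 N0.
have d0 : 0 < N%:R^-1 :> R by rewrite invr_gt0 ltr0n.
have blockE (f : R -> R) : \sum_(0 <= k < N * N) f (block_state N k) =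
    f N%:R^-1 *+ (N * N).
  rewrite big_nat (eq_bigr (fun=> f N%:R^-1)); last first.
    by move=> k /andP[_ kN]; rewrite /block_state kN.
  by rewrite -big_nat sumr_const_nat subn0.
have x0 : block_state N 0 = N%:R^-1 by rewrite /block_state NN0.
exists (N * N)%N, 0%N, 0%N; rewrite x0; split => //.
- by move=> k kN; rewrite /block_state ltnNge kN.
- by move=> k; rewrite /block_state; case: ifP => _; rewrite ?lexx ltW.
split.
- move=> k _; rewrite /block_state; case: ifP => _; [right|by left].
  by have := ltW d0; lra.
- rewrite (blockE id) /B1 /B2 !big_geq // !mulr0 sub0r mulrN oppr_le0.
  by rewrite mulr_ge0 ?mulrn_wge0 // ltW.
- rewrite (blockE (fun r => r ^+ 2)) /B2 big_geq // mulr0 subr0.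
  rewrite -[_ *+ (N * N)]mulr_natr natrM -expr2 -exprMn mulVf ?expr1n ?lexx //.
  by rewrite pnatr_eq0 -lt0n.
Qed.

(** Rotations occur only when a coordinate reaches [20 * b m], and coordinates never exceed [1/N];
    hence the bound on [t m] is asked only for [b m <= 1/(20 N)]. [Bc] makes room for a part of the
    sum in (T) not contained in [B1]. *)
Lemma plane_steps_exist (t : nat -> R) (N : nat) Bc :
  (forall n, 0 <= t n <= 1) -> (forall n, 0 <= b n) -> (0 < N)%N ->
  0 <= Bc <= N%:R -> (forall m, 812 * B2 m <= 2^-1) ->
  (forall m, b m <= N%:R^-1 / 20 -> 15 * t m <= b m * (Bc + B1 m.+1)) ->
  exists x : nat -> nat -> R, forall m,
    [/\ plane_step (t m) (x m) (x m.+1) & exists2 n, vanish_from (x m) n &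
      2^-1 <= \sum_(0 <= k < n) x m k ^+ 2].
Proof.
move=> t01 b0 N0 /andP[Bc0 BcN] hB2 hb.
set delta := N%:R^-1 in hb.
have N1 : 1 <= N%:R :> R by rewrite ler1n.
have d1 : delta <= 1 by rewrite invf_le1 // ltr0n.
have Bcd : Bc * delta <= 1 by rewrite ler_pdivrMr ?mul1r // ltr0n.
(* Off the invariant the successor is arbitrary, which makes the choice function total. *)
have next m x : exists y, state_inv delta m x ->
    state_inv delta m.+1 y /\ plane_step (t m) x y.
  have [hx|?] := EM (state_inv delta m x); last by exists x.
  have [tau0 _] := andP (t01 m).
  have [small|/existsNP[k /negP]] := EM (forall k, x k <= 20 * b m).
    by have [y y1 y2] := step_kill (t01 m) (b0 m) (hB2 m) hx small; exists y.
  rewrite -ltNge => /ltW xk.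
  have hbm : b m <= delta / 20.
    have [n [i [j [_ xi xid _]]]] := hx.
    by have /andP[_ xki] := xi k; lra.
  have [y y1 y2] := step_rotate tau0 (b0 m) Bc0 Bcd d1 (hB2 m) hx (hb m hbm)
    (ex_intro _ k xk).
  by exists y.
have /choice[F hF] : forall mx : nat * (nat -> R), exists y,
    state_inv delta mx.1 mx.2 ->
    state_inv delta mx.1.+1 y /\ plane_step (t mx.1) mx.2 y.
  by case=> m x; exact: next.
pose x := fix x m := if m is m'.+1 then F (m', x m') else block_state N.
have xinv m : state_inv delta m (x m).
  by elim: m => [|m IH]; [exact: state_inv_block | exact: (hF (m, x m) IH).1].
exists x => m; split; first exact: (hF (m, x m) (xinv m)).2.
have [n [i [j [xn _ _ [_ _ /andP[hl2 _]]]]]] := xinv m.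
have B20 : 0 <= B2 m by apply: sumr_ge0 => k _; exact: sqr_ge0.
by exists n => //; have := hB2 m; lra.
Qed.

End Dynamics.

Lemma not_condition_T_plane_steps (R : realType) (t : nat -> R) :
  (forall n, 0 <= t n <= 1) -> ~ condition_T t ->
  exists x : nat -> nat -> R, forall m,
    [/\ plane_step (t m) (x m) (x m.+1) & exists2 n, vanish_from (x m) n &
      2^-1 <= \sum_(0 <= k < n) x m k ^+ 2].
Proof.
move=> t01 nT; have t0 n : 0 <= t n by have /andP[] := t01 n.
have [a [c [N0 [a0 l2a c0 hc]]]] := not_condition_T t0 nT.
(* Scaling [a] by [K] multiplies the products in (T) by [K^2], chosen so that [K^2 * c >= 15]. *)
pose K := 1 + 15 / c.
have c15 : 0 < 15 / c by rewrite divr_gt0.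
have K1 : 1 <= K by rewrite lerDl ltW.
have K0 : 0 < K by rewrite (lt_le_trans ltr01).
have Kc : 15 <= K ^+ 2 * c.
  have Kc1 : 15 <= K * c by rewrite mulrDl mul1r divfK ?gt_eqF // lerDr ltW.
  by rewrite expr2 -mulrA; have := ler_wpM2r (le_trans (ler0n _ 15) Kc1) K1; lra.
have K20 : 0 < K ^+ 2 by rewrite exprn_gt0.
(* [3248 = 4 * 812]: the tail uses up at most [1/4] of the allowed [1/2]. *)
have [e e0 eE] : exists2 e : R, 0 < e & K ^+ 2 * e = 1 / 3248.
  exists ((1 / 3248) / K ^+ 2); last by rewrite mulrC divfK ?gt_eqF.
  by apply: divr_gt0; [lra | exact: K20].
have [N1 tail] := nonneg_series_tail (fun n => sqr_ge0 (a n.+1)) l2a e0.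
(* The successor accounts for the shift in [in_l2], whose series starts at [a 1]. *)
pose m0 := maxn N0 N1.+1.
have m00 : (0 < m0)%N by rewrite leq_max orbT.
have a0' k : (m0 <= k)%N -> 0 <= a k by move=> h; apply: a0; exact: leq_trans h.
have tail' n : \sum_(m0 <= l < n) a l ^+ 2 <= e.
  case: n => [|n]; first by rewrite big_geq // ltW.
  have [nm|mn] := leqP n.+1 m0; first by rewrite big_geq // ltW.
  apply: le_trans (tail n); rewrite -(big_add1 _ _ N1 n.+1 predT (fun k => a k ^+ 2)).
  rewrite (big_cat_nat (leq_maxr N0 N1.+1) (ltnW mn)) /= lerDr.
  by apply: sumr_ge0 => k _; exact: sqr_ge0.
pose Bc := K * \sum_(1 <= nu < m0) a nu.
have Bc0 : 0 <= Bc.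
  rewrite mulr_ge0 ?(ltW K0) // big_nat sumr_ge0 // => k /andP[k1 _]; exact: a0.
(* [N >= Bc] keeps [Bc * delta <= 1], and [N >= 40 * m0] makes the square sum of [b] before [m0] at
   most [1/4000]. *)
pose N := (Num.trunc Bc + 40 * m0).+1.
have BcN : Bc <= N%:R.
  by apply: ltW; apply: lt_le_trans (truncnS_gt _) _; rewrite ler_nat ltnS leq_addr.
have mN : 40 * m0%:R <= N%:R :> R by rewrite -natrM ler_nat leqW // leq_addl.
set delta : R := N%:R^-1.
have d0 : 0 < delta by rewrite invr_gt0 ltr0n.
have d1 : delta <= 1 by rewrite invf_le1 ?ltr0n // ler1n.
have md : 40 * m0%:R * delta <= 1 by rewrite ler_pdivrMr ?mul1r // ltr0n.
(* b is large before m0, which forces the dynamics to discard mass there. *)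
pose b l := if (l < m0)%N then delta / 10 else K * a l.
have b0 l : 0 <= b l.
  rewrite /b; case: ltnP => h; first by rewrite divr_ge0 // ltW.
  by rewrite mulr_ge0 ?(ltW K0) ?a0'.
have b_lo : \sum_(0 <= l < m0) b l ^+ 2 = m0%:R * (delta / 10) ^+ 2.
  rewrite big_nat (eq_bigr (fun=> (delta / 10) ^+ 2)).
    by rewrite -big_nat sumr_const_nat subn0 mulr_natl.
  by move=> k /andP[_ km]; rewrite /b km.
have b_hi (f : R -> R) n :
    \sum_(m0 <= l < n) f (b l) = \sum_(m0 <= l < n) f (K * a l).
  rewrite [LHS]big_nat [RHS]big_nat; apply: eq_bigr => k /andP[mk _].
  by rewrite /b ltnNge mk.
apply: (@plane_steps_exist _ b t N Bc) => //.
- by rewrite Bc0.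
- move=> m; have mm : (m0 <= m0 + m)%N by rewrite leq_addr.
  have := le_sum_nat (fun l => sqr_ge0 (b l)) (leq_addl m0 m).
  rewrite (big_cat_nat (leq0n m0) mm) /= b_lo (b_hi (fun r => r ^+ 2)).
  under [X in _ <= _ + X]eq_bigr do rewrite exprMn.
  rewrite -mulr_sumr.
  have := ler_wpM2l (ltW K20) (tail' (m0 + m)%N).
  rewrite eE.
  have : m0%:R * (delta / 10) ^+ 2 <= 4000^-1.
    have : 40 * m0%:R * delta * delta <= 1 * 1 by
      apply: ler_pM md d1; rewrite ?mulr_ge0 ?ler0n ?(ltW d0).
    lra.
  lra.
(* Before [m0] the value [delta / 10] exceeds [delta / 20], so only indices from [m0] on are
   concerned. *)
move=> m hbm; have mm : (m0 <= m)%N.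
  by rewrite leqNgt; apply/negP => h; move: hbm; rewrite -/delta /b h; lra.
have bE : b m = K * a m by rewrite /b ltnNge mm.
rewrite (big_cat_nat (leq0n m0) (leqW mm)) /= (b_hi id) -mulr_sumr bE /Bc.
have := hc m (leq_trans (leq_maxl _ _) mm); rewrite (big_cat_nat m00 (leqW mm)) /=.
move=> /(ler_wpM2l (ltW K20)); have := ler_wpM2r (t0 m) Kc.
have : 0 <= K * a m * \sum_(0 <= l < m0) b l.
  by rewrite mulr_ge0 ?mulr_ge0 ?(ltW K0) ?a0' ?sumr_ge0.
lra.
Qed.

(** * Hyperplanes orthogonal to planar vectors *)

Section Hyperplane.
Variables (R : realType) (V : lmodType R) (ip : V -> V -> R).
Hypothesis H : is_real_hilbert ip.

Definition hyperplane (w : V) : set V := [set x | ip x w = 0].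

Lemma closed_hyperplane w : closed_set ip (hyperplane w).
Proof.
move=> u l uw ul; apply/eqP; rewrite -normr_le0; apply/ler_addgt0Pr => e e0.
rewrite add0r; have w0 := ipnorm_ge0 ip w.
have ew : 0 < e / (ipnorm ip w + 1) by rewrite divr_gt0 // ltr_wpDl.
have [N hN] := ul _ ew; have := hN N (leqnn N); rewrite ipnormBC // => lN.
have -> : ip l w = ip (l - u N) w.
  by rewrite ipBl //; have /= -> : ip (u N) w = 0 := uw N; rewrite subr0.
apply: le_trans (cauchy_schwarz H _ _) _.
apply: le_trans (ler_wpM2r w0 (ltW lN)) _.
by rewrite -mulrA ler_piMr ?(ltW e0) // mulrC ler_pdivrMr ?mul1r ?ltr_wpDl // lerDl.
Qed.

Lemma convex_hyperplane w : convex_subset (hyperplane w).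
Proof.
move=> x y lam; rewrite /hyperplane /= => xw yw _; rewrite (ipDl H) !(ipZl H).
by rewrite xw yw !mulr0 addr0.
Qed.

Lemma hyperplane_proj w x : 0 < ip w w ->
  is_proj ip (hyperplane w) x (x - (ip x w / ip w w) *: w).
Proof.
move=> w0; set lam := _ / _; have lamE : lam * ip w w = ip x w by rewrite divfK ?gt_eqF.
split=> [|y yw]; first by rewrite /hyperplane /= ipBl // ipZl // lamE subrr.
have -> : x - (x - lam *: w) = lam *: w by rewrite opprB addrC subrK.
rewrite -ler_sqr ?nnegrE ?ipnorm_ge0 // !sqr_ipnorm //.
have := ip_ge0 H (x - y - lam *: w); have /= yw0 : ip y w = 0 := yw.
have xyw : ip (x - y) w = ip x w by rewrite ipBl // yw0 subr0.
move: (x - y) xyw => z zw.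
rewrite !(ipE H) (ipC H w z) zw -lamE; lra.
Qed.

Lemma sqr_dist_hyperplane w x : 0 < ip w w ->
  dist ip x (hyperplane w) ^+ 2 * ip w w = ip x w ^+ 2.
Proof.
move=> w0; rewrite (dist_proj (hyperplane_proj x w0)).
have -> : x - (x - (ip x w / ip w w) *: w) = (ip x w / ip w w) *: w.
  by rewrite opprB addrC subrK.
rewrite sqr_ipnorm // ipZl // ipZr //.
by field; rewrite gt_eqF.
Qed.

Lemma hyperplane_quasi_sym (I : Type) (w : I -> V) :
  unif_quasi_sym_wrt ip (fun i => hyperplane (w i)) 0.
Proof.
move=> r _; exists 1; split; first by rewrite ltr01 lexx.
by move=> i x; rewrite /hyperplane /= !add0r ipZl // => -> _; rewrite mulr0.
Qed.

End Hyperplane.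

Section PlanarHyperplanes.
Variable R : realType.
Local Notation V := (ell2 R).
Local Notation ip := (@ell2_ip R).
Local Notation H := (ell2_hilbert R).
Implicit Types (x y : V).

Lemma vanish_from_sq_summable (x : nat -> R) n : vanish_from x n -> x \in @sq_summable R.
Proof.
move=> xn; apply/sq_summableP; exists (\sum_(0 <= k < n) x k ^+ 2) => m.
rewrite -(sum_vanish_from (f := fun r => r ^+ 2) (n := maxn m n) _ xn) ?leq_maxr ?expr0n //.
by apply: le_sum_nat (leq_maxl _ _) => k; exact: sqr_ge0.
Qed.

Lemma delta_vanish p : vanish_from (fun k => (k == p)%:R : R) p.+1.
Proof. by move=> k pk; rewrite gtn_eqF. Qed.

Definition ell2_delta p : V := Ell2 (vanish_from_sq_summable (@delta_vanish p)).

Lemma ip_delta x p : ip x (ell2_delta p) = x p.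
Proof.
rewrite ell2_ipC (@ell2_ip_fsupp _ _ _ p.+1); last exact: delta_vanish.
rewrite big_nat_recr //= eqxx mul1r big_nat big1 ?add0r // => k /andP[_ kp].
by rewrite ltn_eqF ?mul0r.
Qed.

(** Index set of the counterexample: a nonzero normal vector together with the coordinate plane
    containing it. *)
Record planar := Planar {
  planar1 : nat; planar2 : nat; coef1 : R; coef2 : R;
  planar_neq : planar1 != planar2;
  coef_gt0 : 0 < coef1 ^+ 2 + coef2 ^+ 2 }.

Definition planar_vec (al : planar) : V :=
  coef1 al *: ell2_delta (planar1 al) + coef2 al *: ell2_delta (planar2 al).

Definition planar_hyp (al : planar) := hyperplane ip (planar_vec al).

Lemma ip_planar x al :
  ip x (planar_vec al) = coef1 al * x (planar1 al) + coef2 al * x (planar2 al).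
Proof. by rewrite (ipDr H) !(ipZr H) !ip_delta. Qed.

Lemma ip_planar_vec al : ip (planar_vec al) (planar_vec al) = coef1 al ^+ 2 + coef2 al ^+ 2.
Proof.
rewrite ip_planar.
have E k : planar_vec al k = coef1 al * (k == planar1 al)%:R + coef2 al * (k == planar2 al)%:R.
  by [].
rewrite !E !eqxx (negbTE (planar_neq al)) eq_sym (negbTE (planar_neq al)) /=; ring.
Qed.

Lemma planar_vec_gt0 al : 0 < ip (planar_vec al) (planar_vec al).
Proof. by rewrite ip_planar_vec coef_gt0. Qed.

Lemma sqr_dist_planar x al : dist ip x (planar_hyp al) ^+ 2 =
  (coef1 al * x (planar1 al) + coef2 al * x (planar2 al)) ^+ 2 /
    (coef1 al ^+ 2 + coef2 al ^+ 2).
Proof.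
rewrite -ip_planar -(sqr_dist_hyperplane H x (planar_vec_gt0 al)) ip_planar_vec.
by rewrite mulfK // gt_eqF ?coef_gt0.
Qed.

Lemma sqr_dist_planar_le x al : dist ip x (planar_hyp al) ^+ 2 <=
  x (planar1 al) ^+ 2 + x (planar2 al) ^+ 2.
Proof.
rewrite sqr_dist_planar ler_pdivrMr ?coef_gt0 //.
have := sqr_ge0 (coef1 al * x (planar2 al) - coef2 al * x (planar1 al)); lra.
Qed.

Lemma ell2_sqr_vanish x e : 0 < e ->
  exists N, forall k, (N <= k)%N -> x k ^+ 2 < e.
Proof.
move=> e0; have e2 : 0 < e / 2 by rewrite divr_gt0.
have [N hN] := nonneg_series_tail (fun k => sqr_ge0 (x k)) (asboolP _ (ell2P x)) e2.
exists N => k Nk; have := hN k.+1; rewrite big_nat_recr //= => h.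
have : 0 <= \sum_(N <= i < k) x i ^+ 2 by apply: sumr_ge0 => i _; exact: sqr_ge0.
lra.
Qed.

(** Attainment is demanded when some [t n] equals 1. Square summability provides two largest
    coordinates in absolute value, and the part of [x] in their plane is the optimal normal. *)
Lemma planar_dist_max x : exists be, forall al,
  dist ip x (planar_hyp al) <= dist ip x (planar_hyp be).
Proof.
have x20 k : 0 <= x k ^+ 2 by exact: sqr_ge0.
have [i _ hi] := vanishing_argmax (P := predT) x20 (@ell2_sqr_vanish x) (ex_intro _ 0%N isT).
have [q qi hq] := vanishing_argmax (P := fun k => k != i) x20 (@ell2_sqr_vanish x)
  (ex_intro _ i.+1 (negbT (gtn_eqF (ltnSn i)))).
have iq : i != q by rewrite eq_sym.
have le_W al : dist ip x (planar_hyp al) ^+ 2 <= x i ^+ 2 + x q ^+ 2.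
  apply: le_trans (sqr_dist_planar_le x al) _.
  by apply: (two_largest_le (y := fun k => x k ^+ 2)) (planar_neq al) => // k; exact: hi.
suff [be hbe] : exists be, dist ip x (planar_hyp be) ^+ 2 = x i ^+ 2 + x q ^+ 2.
  exists be => al; rewrite -ler_sqr ?nnegrE ?dist_ge0 // hbe; exact: le_W.
have : 0 <= x i ^+ 2 + x q ^+ 2 by rewrite addr_ge0.
(* If both coordinates vanish that normal is zero, but then every distance is 0 and any index will
   do. *)
rewrite le_eqVlt => /orP[/eqP W0|W0].
  have c0 : 0 < 1 ^+ 2 + 0 ^+ 2 :> R by rewrite expr1n expr0n addr0.
  exists (Planar iq c0); apply: le_anti; rewrite le_W -W0; exact: sqr_ge0.
exists (Planar iq W0); rewrite sqr_dist_planar /= -!expr2.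
by rewrite [in X in X / _]expr2 mulfK // gt_eqF.
Qed.

Lemma plane_step_remote tau x y : 0 <= tau -> plane_step tau x y ->
  exists al, tau * sup [set dist ip x (planar_hyp be) | be in [set: planar]]
    <= dist ip x (planar_hyp al) /\ is_proj ip (planar_hyp al) x y.
Proof.
move=> tau0 [p [q [w1 [w2 [pq w0 yE far]]]]].
pose al := Planar pq w0; exists al; split.
  have le_al be : tau * dist ip x (planar_hyp be) <= dist ip x (planar_hyp al).
    rewrite -ler_sqr ?nnegrE ?mulr_ge0 ?dist_ge0 // exprMn.
    apply: le_trans (ler_wpM2l (sqr_ge0 tau) (sqr_dist_planar_le x be)) _.
    by rewrite sqr_dist_planar ler_pdivlMr //=; exact: far (planar_neq be).
  have := tau0; rewrite le_eqVlt => /orP[/eqP <-|tau_gt0].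
    by rewrite mul0r dist_ge0.
  rewrite mulrC -ler_pdivlMr //; apply: ge_sup.
    by exists (dist ip x (planar_hyp al)), al.
  by move=> _ [be _ <-]; rewrite ler_pdivlMr // mulrC.
suff -> : y = x - (ip x (planar_vec al) / ip (planar_vec al) (planar_vec al)) *: planar_vec al.
  exact: hyperplane_proj H _ _ (planar_vec_gt0 al).
apply: ell2_eqP => k; rewrite ip_planar ip_planar_vec yE /=.
change (plane_proj x p q w1 w2 k = x k - plane_lam x p q w1 w2 *
  (w1 * (k == p)%:R + w2 * (k == q)%:R)).
rewrite /plane_proj /update2 /update; have [->|_] := eqVneq k p.
  by rewrite (negbTE pq) mulr1 mulr0 addr0.
by have [->|_] := eqVneq k q; rewrite ?mulr1 !mulr0 add0r ?mulr0 ?subr0.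
Qed.

(** The hyperplane normal to the [k]-th unit vector forces coordinate [k] to vanish. *)
Lemma planar_hyp_bigcap l : (forall al, planar_hyp al l) -> l = 0.
Proof.
move=> hl; apply: ell2_eqP => k.
have kk : k != k.+1 by rewrite ltn_eqF.
have c0 : 0 < 1 ^+ 2 + 0 ^+ 2 :> R by rewrite expr1n expr0n addr0.
have := hl (Planar kk c0); rewrite /planar_hyp /hyperplane /= ip_planar /=.
by rewrite mul1r mul0r addr0.
Qed.

End PlanarHyperplanes.

(** * Divergence when (T) fails, and the equivalence *)

Lemma not_condition_T_divergent (R : realType) (t : nat -> R) :
  (forall n, 0 <= t n <= 1) -> ~ condition_T t ->
  exists x : nat -> ell2 R,
    remote_projections (@ell2_ip R) (@planar_hyp R) t (x 0%N) x /\
    ~ seq_converges (@ell2_ip R) x 0.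
Proof.
move=> t01 /(not_condition_T_plane_steps t01)[f hf].
have fP m : f m \in @sq_summable R.
  by have [_ [n fn _]] := hf m; exact: vanish_from_sq_summable fn.
pose x m := Ell2 (fP m); exists x; split.
  split => //; first by move=> _ y; exact: planar_dist_max.
  move=> n; have [step _] := hf n; have /andP[tn _] := t01 n.
  exact: plane_step_remote.
have h0 : 0 < 2^-1 :> R by rewrite invr_gt0.
(* A norm below [1/2] has square below [1/4], against the lower bound [1/2] on the squared norms. *)
move=> /(_ _ h0)[N /(_ N (leqnn N))]; rewrite subr0 => xN.
have := hf N => -[_ [n _ l2N]].
have := ell2_ip_ge (x N) n; rewrite -(sqr_ipnorm (ell2_hilbert R)).
have := ltW xN; rewrite -ler_sqr ?nnegrE ?ipnorm_ge0 ?(ltW h0) //.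
have : \sum_(0 <= k < n) x N k ^+ 2 = \sum_(0 <= k < n) f N k ^+ 2 by [].
lra.
Qed.

Theorem theorem1 (R : realType) (t : nat -> R) (ht : forall n, 0 <= t n <= 1) :
  condition_T t <->
  (forall (V : lmodType R) (ip : V -> V -> R), is_real_hilbert ip ->
   forall (Omega : Type) (C : Omega -> set V),
     (exists alpha beta : Omega, alpha <> beta) ->
     (forall alpha, closed_set ip (C alpha) /\ convex_subset (C alpha)) ->
     forall a : V, (forall alpha, C alpha a) -> unif_quasi_sym_wrt ip C a ->
     forall (x0 : V) (x : nat -> V), remote_projections ip C t x0 x ->
       exists l : V, (forall alpha, C alpha l) /\ seq_converges ip x l).
Proof.
have t0 n : 0 <= t n by have /andP[] := ht n.
split=> [hT V ip H Omega C _ cC a Ca qs x0 x xR | conv].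
  exact: remote_projections_converge t0 hT H cC Ca qs xR.
apply: contrapT => /(not_condition_T_divergent ht)[x [xR x_div]].
have H := ell2_hilbert R.
have c0 : 0 < 1 ^+ 2 + 0 ^+ 2 :> R by rewrite expr1n expr0n addr0.
have planar2_neq : exists al be : planar R, al <> be.
  exists (Planar (isT : 0 != 1)%N c0), (Planar (isT : 0 != 2)%N c0).
  by move=> /(congr1 (@planar2 R)).
have hyp_cc (al : planar R) : closed_set (@ell2_ip R) (planar_hyp al) /\
    convex_subset (planar_hyp al).
  by split; [exact: closed_hyperplane | exact: convex_hyperplane].
have hyp0 (al : planar R) : planar_hyp al 0 by exact: ip0l.
(* The limit supplied by (ii) lies in all the hyperplanes, hence is 0, the one limit that has been
   excluded. *)
have [l [hl xl]] := conv _ _ H _ _ planar2_neq hyp_cc 0 hyp0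
  (hyperplane_quasi_sym H _) _ _ xR.
by apply: x_div; rewrite -(planar_hyp_bigcap hl).
Qed.
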